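(* There exists a function $f:\mathbb{N}\to\mathbb{R}_{>0}$ with $f(N)\to0$ as $N\to\infty$ such that the following holds. Let $G$ be a group (not necessarily abelian) and let $S,T,X$ be finite nonempty subsets of $G$, and put $Z=XST$. Then there exist subsets $S'\subseteq S$ and $T'\subseteq T$ such that $ST=(S'T)\cup(ST')$ and \[ |S'|+|T'|\le f(|Z|)\,\frac{|Z|^2}{|X|}. \]
   Context: For subsets $U,V$ of a group, $UV=\{uv:u\in U,v\in V\}$, and $XST=\{xst:x\in X,s\in S,t\in T\}$. *)

(* Defs.v *)
From HB Require Import structures.
From mathcomp Require Import all_boot.
From mathcomp Require Import finmap.
From Stdlib Require Import Reals.
Set Implicit Arguments. Unset Strict Implicit. Unset Printing Implicit Defensive.
Local Open Scope fset_scope.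

Definition setmulf (G : groupType) (U V : {fset G}) : {fset G} :=
  [fset ((u * v)%g) | u in U, v in V].

(* Main.v *)
(** Choose pairs (s_1, t_1), (s_2, t_2), ... in S * T greedily so that
    z_k := s_k t_k lies neither in s_i T nor in S t_i for i < k; when no further
    choice is possible, the s_i and the t_i form S' and T'.  It remains to show
    that |X| m = o(|Z|^2), where m is the number of pairs.

    Join v in XS to w in XST when v^-1 w is in T.  For each x in X the pairs
    (x s_i, x z_i) form a matching in this bipartite graph with no edge from
    x s_i to x z_k for i < k, and these matchings are edge-disjoint.  Partition
    both vertex sets into boundedly many blocks.  Leaving out, for each x, the
    indices i with few predecessors in the block of x s_i or few successors in
    the block of x z_i costs little.  Every other edge (x s_i, x z_i) lies in a
    pair of blocks containing a large edge-free rectangle: predecessors of i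
    against successors of i.  Cutting the blocks along these rectangles
    increases the number of vertex pairs lying in edge-free pairs of blocks by a
    fixed proportion of |Z|^2, which can happen only boundedly often.  Unlike in
    Szemeredi's regularity lemma, no density or energy is needed. *)

Require Import Defs.
From HB Require Import structures.
From mathcomp Require Import all_boot.
From mathcomp Require Import finmap.
From Stdlib Require Import Reals Lra.
From mathcomp Require Import zify ssrnat.
Set Implicit Arguments. Unset Strict Implicit. Unset Printing Implicit Defensive.

(** * Counting along the blocks of a partition *)

Lemma card_fibers (T I : finType) (P : T -> I) (D : {set T}) :
  #|D| = \sum_(p : I) #|[set x in D | P x == p]|.
Proof.
rewrite -sum1_card (partition_big P predT) //=.
apply: eq_bigr => p _; rewrite -sum1_card.
by apply: eq_bigl => x; rewrite inE.
Qed.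

(* In each fiber of P \o b the indices counted here precede the last of them, so
   their number is at most one more than its rank. *)
Lemma few_low_rank (K V I : finType) (lt : rel K) (P : V -> I) (b : K -> V)
    (a : nat) :
  irreflexive lt -> transitive lt ->
  (forall i j, i != j -> lt i j || lt j i) ->
  a * #|[set i | a * #|[set j | lt j i & P (b j) == P (b i)]|
                 < #|[set v | P v == P (b i)]|]| <= #|V| + a * #|I|.
Proof.
move=> lt_irr lt_tr lt_tot.
pose rk i := #|[set j | lt j i & P (b j) == P (b i)]|.
set D := [set i | _].
rewrite (card_fibers (P \o b) D) -cardsT (card_fibers P [set: V]) big_distrr /=.
rewrite mulnC -sum_nat_const -big_split /=; apply: leq_sum => p _.
set Dp := [set x in D | _].
have [->|/set0Pn[i0 i0D]] := eqVneq Dp set0; first by rewrite cards0 muln0.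
case: (@arg_maxnP _ i0 (mem Dp) rk) => //= i iD imax.
have [aD Pi] : a * rk i < #|[set v | P v == P (b i)]| /\ P (b i) = p.
  by move: iD; rewrite !inE => /andP[? /eqP].
have sub : Dp \subset i |: [set j | lt j i & P (b j) == P (b i)].
  apply/subsetP => j jD; rewrite !inE.
  have [//|ji] := eqVneq j i.
  have Pj : P (b j) = p by move: jD; rewrite !inE => /andP[_ /eqP].
  rewrite Pj Pi eqxx andbT /=.
  (* If [i] preceded [j], then [i] and its predecessors in the fiber would all count for [j],
     against the maximal rank of [i]. *)
  have /orP[//|ij] := lt_tot _ _ ji.
  have: rk j <= rk i by apply: imax.
  rewrite leqNgt => /negP[]; apply: proper_card; apply/properP; split.
    apply/subsetP => k; rewrite !inE Pi Pj => /andP[ki ->].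
    by rewrite (lt_tr _ _ _ ki ij).
  by exists i; rewrite !inE ?lt_irr // ij Pi Pj eqxx.
have := subset_leq_card sub; rewrite cardsU1 -/(rk i).
have le1 : (i \notin [set j | lt j i & P (b j) == P (b i)]) <= 1 by case: (_ \notin _).
move=> lD.
have -> : [set x in [set: V] | P x == p] = [set v | P v == P (b i)].
  by apply/setP => v; rewrite !inE Pi.
nia.
Qed.

(** * Edge-free pairs of blocks and their refinement *)

Section Vacancy.
Variables (V W : finType) (E : V -> W -> bool).

(** Vertex pairs rather than block pairs, so that the cardinality stays at most [#|V| * #|W|]
    however fine the partitions are. *)
Definition vacant (I J : finType) (P : V -> I) (Q : W -> J) : {set V * W} :=
  [set u | [forall v, forall w,
     (P v == P u.1) && (Q w == Q u.2) ==> ~~ E v w]].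

Lemma vacantP (I J : finType) (P : V -> I) (Q : W -> J) u :
  reflect (forall v w, P v = P u.1 -> Q w = Q u.2 -> ~~ E v w)
          (u \in vacant P Q).
Proof.
rewrite inE; apply: (iffP forallP) => [H v w Pv Qw | H v].
  by have /forallP/(_ w) := H v; rewrite Pv Qw !eqxx.
by apply/forallP => w; apply/implyP => /andP[/eqP Pv /eqP Qw]; apply: H.
Qed.

(* An edge-free rectangle with relative side lengths at least 1/a. *)
Definition hole (a : nat) (I J : finType) (P : V -> I) (Q : W -> J) p q
    (U : {set V} * {set W}) : bool :=
  [&& U.1 \subset [set v | P v == p], U.2 \subset [set w | Q w == q],
      #|[set v | P v == p]| <= a * #|U.1|,
      #|[set w | Q w == q]| <= a * #|U.2| &
      [forall v in U.1, forall w in U.2, ~~ E v w]].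

(** A pair of blocks meeting [F] contains an edge, so none of its vertex pairs is vacant; cutting
    along one hole makes at least a [1 / a ^ 2] share of them vacant. *)
Lemma refine_vacant (a k : nat) (I J : finType) (P : V -> I) (Q : W -> J)
    (F : {set V * W}) :
  #|I| <= k -> #|J| <= k ->
  (forall u, u \in F -> E u.1 u.2 && [exists U, hole a P Q (P u.1) (Q u.2) U]) ->
  exists (I' J' : finType) (P' : V -> I') (Q' : W -> J'),
    [/\ #|I'| <= k * 2 ^ k, #|J'| <= k * 2 ^ k &
        a ^ 2 * #|vacant P Q| + #|F| <= a ^ 2 * #|vacant P' Q'|].
Proof.
move=> Ik Jk FE.
(* Pairs of blocks without a hole get the empty rectangle, which cuts nothing. *)
pose U p q := odflt (set0, set0) [pick U | hole a P Q p q U].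
(* A vertex remembers its block and its side of every cut of that block, whence the factor
   [2 ^ k]. *)
pose P' v := (P v, [set q | v \in (U (P v) q).1]).
pose Q' w := (Q w, [set p | w \in (U p (Q w)).2]).
exists (I * {set J})%type, (J * {set I})%type, P', Q'; split.
- by rewrite card_prod -(cardsT {set _}) -powersetT card_powerset cardsT leq_mul // leq_exp2l.
- by rewrite card_prod -(cardsT {set _}) -powersetT card_powerset cardsT leq_mul // leq_exp2l.
pose bad : {set I * J} := [set (P u.1, Q u.2) | u in F].
have badP pq : pq \in bad -> hole a P Q pq.1 pq.2 (U pq.1 pq.2).
  case/imsetP => u uF -> /=; have /andP[_ /existsP[U0 hU0]] := FE _ uF.
  by rewrite /U; case: pickP => [//|/(_ U0)]; rewrite hU0.
pose B := [set u : V * W | ((P u.1, Q u.2) \in bad)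
   && ((u.1 \in (U (P u.1) (Q u.2)).1) && (u.2 \in (U (P u.1) (Q u.2)).2))].
have sub1 : vacant P Q \subset vacant P' Q'.
  apply/subsetP => u /vacantP H; apply/vacantP => v w [Pv _] [Qw _].
  exact: H.
have sub2 : B \subset vacant P' Q'.
  apply/subsetP => u; rewrite inE => /and3P[uB u1 u2].
  apply/vacantP => v w [Pv /setP Pv'] [Qw /setP Qw'].
  have := Pv' (Q u.2); rewrite !inE u1 Pv => v1.
  have := Qw' (P u.1); rewrite !inE u2 Qw => w2.
  have /and5P[_ _ _ _ /forall_inP/(_ v v1)/forall_inP/(_ w w2)] := badP _ uB.
  by [].
have dis : [disjoint vacant P Q & B].
  rewrite -setI_eq0; apply/eqP/setP => u; rewrite !in_setI in_set0.
  apply/andP => -[/vacantP H]; rewrite inE => /andP[/imsetP[u' /FE/andP[Eu' _]] [Pu Qu] _].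
  by have := H u'.1 u'.2 (esym Pu) (esym Qu); rewrite Eu'.
have cB : #|F| <= a ^ 2 * #|B|.
  rewrite (card_fibers (fun u => (P u.1, Q u.2)) F).
  rewrite (card_fibers (fun u => (P u.1, Q u.2)) B) big_distrr /=.
  apply: leq_sum => -[p q] _.
  have [pqB|pqB] := boolP ((p, q) \in bad); last first.
    rewrite (_ : [set _ in _ | _] = set0) ?cards0 //.
    apply/setP => u; rewrite !inE; apply/andP => -[uF /eqP pq].
    by move/negP: pqB; apply; rewrite -pq; apply: imset_f.
  have /and5P[/= s1 s2 c1 c2 _] := badP _ pqB.
  have -> : [set x in B | (P x.1, Q x.2) == (p, q)] = setX (U p q).1 (U p q).2.
    apply/setP => -[v w]; rewrite !inE /=; apply/idP/idP.
      by move=> /andP[/and3P[_ h1 h2] /eqP[hp hq]]; move: h1 h2; rewrite hp hq => -> ->.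
    move=> /andP[h1 h2].
    move: (subsetP s1 _ h1) (subsetP s2 _ h2); rewrite !inE => /eqP hp /eqP hq.
    by rewrite hp hq pqB h1 h2 eqxx.
  apply: (@leq_trans #|setX [set v | P v == p] [set w | Q w == q]|).
    apply: subset_leq_card; apply/subsetP => -[v w]; rewrite !inE /=.
    by case/andP=> _ /eqP[-> ->]; rewrite !eqxx.
  rewrite !cardsX (_ : a ^ 2 * _ = (a * #|(U p q).1|) * (a * #|(U p q).2|)).
    exact: leq_mul.
  by rewrite expnS expn1 mulnACA.
have : #|vacant P Q| + #|B| <= #|vacant P' Q'|.
  rewrite -(cardsUI (vacant P Q)) (_ : _ :&: _ = set0) ?cards0 ?addn0.
    by apply: subset_leq_card; rewrite subUset sub1.
  by apply/eqP; rewrite setI_eq0.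
move=> le_card; apply: leq_trans (leq_mul (leqnn (a ^ 2)) le_card).
by rewrite mulnDr leq_add2l.
Qed.

Fixpoint block_count (t : nat) : nat :=
  if t is t'.+1 then block_count t' * 2 ^ block_count t' else 1.

Lemma block_count_homo : {homo block_count : s t / s <= t}.
Proof.
apply: homo_leq => // [|t /=]; first exact: leq_trans.
by rewrite leq_pmulr // expn_gt0.
Qed.

(** * Edge-disjoint ordered matchings *)

Variables (A : finType) (m : nat) (b : A -> 'I_m -> V) (c : A -> 'I_m -> W).
Hypotheses (b_inj : forall x, injective (b x)) (c_inj : forall x, injective (c x)).
Hypothesis bc_inj : injective (fun xi : A * 'I_m => (b xi.1 xi.2, c xi.1 xi.2)).
Hypothesis bcE : forall x i, E (b x i) (c x i).
Hypothesis bcN : forall x (i k : 'I_m), i < k -> ~~ E (b x i) (c x k).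

(** The hole for index [i] joins ends of index [j < i] in the block of [b x i] to ends of index
    [l > i] in the block of [c x i]: as [j < l], there is no edge. Only indices of low rank are left
    out. *)
Lemma many_edges_in_holes (n a k : nat) (I J : finType) (P : V -> I) (Q : W -> J) :
  #|V| <= n -> #|W| <= n -> #|I| <= k -> #|J| <= k ->
  exists F : {set V * W},
    (forall u, u \in F -> E u.1 u.2 && [exists U, hole a P Q (P u.1) (Q u.2) U]) /\
    #|A| * (a * m) <= a * #|F| + #|A| * (2 * (n + a * k)).
Proof.
move=> Vn Wn Ik Jk.
pose lo x (i : 'I_m) := [set j : 'I_m | j < i & P (b x j) == P (b x i)].
pose hi x (i : 'I_m) := [set j : 'I_m | i < j & Q (c x j) == Q (c x i)].
pose D1 x := [set i : 'I_m | a * #|lo x i| < #|[set v | P v == P (b x i)]|].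
pose D2 x := [set i : 'I_m | a * #|hi x i| < #|[set w | Q w == Q (c x i)]|].
pose H := [set xi : A * 'I_m | xi.2 \notin D1 xi.1 :|: D2 xi.1].
exists [set (b xi.1 xi.2, c xi.1 xi.2) | xi in H]; split.
  move=> u /imsetP[[x i]]; rewrite !inE negb_or -!leqNgt /= => /andP[h1 h2] -> /=.
  rewrite bcE; apply/existsP; exists (b x @: lo x i, c x @: hi x i).
  rewrite /hole /= !card_imset //; apply/and5P; split => //.
  - by apply/subsetP => v /imsetP[j]; rewrite !inE => /andP[_ h] ->.
  - by apply/subsetP => v /imsetP[j]; rewrite !inE => /andP[_ h] ->.
  apply/forall_inP => v /imsetP[j]; rewrite inE => /andP[ji _] ->.
  apply/forall_inP => w /imsetP[l]; rewrite inE => /andP[il _] ->.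
  by apply: bcN; apply: ltn_trans il.
(* By [bc_inj] the matchings are edge-disjoint, so edges are counted by pairs [(x, i)]. *)
rewrite card_imset //.
have D1n x : a * #|D1 x| <= n + a * k.
  apply: leq_trans (leq_add Vn (leq_mul (leqnn a) Ik)).
  apply: (@few_low_rank 'I_m V I (fun i j : 'I_m => i < j)) => [i|i j l|i j].
  - exact: ltnn.
  - exact: ltn_trans.
  - by rewrite -neq_ltn.
have D2n x : a * #|D2 x| <= n + a * k.
  apply: leq_trans (leq_add Wn (leq_mul (leqnn a) Jk)).
  (* The reversed order counts successors. *)
  apply: (@few_low_rank 'I_m W J (fun i j : 'I_m => j < i)) => [i|i j l ij jl|i j].
  - exact: ltnn.
  - exact: ltn_trans jl ij.
  - by rewrite orbC -neq_ltn.
have -> : #|H| = \sum_(x : A) #|~: (D1 x :|: D2 x)|.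
  rewrite (card_fibers fst); apply: eq_bigr => x _.
  have pair_inj : injective (pair x : 'I_m -> A * 'I_m) by move=> i j [].
  rewrite -(card_imset (mem (~: (D1 x :|: D2 x))) pair_inj).
  apply: eq_card => -[y i]; rewrite !inE /=; apply/andP/imsetP.
    by case=> h /eqP e; exists i; rewrite ?inE -?e.
  by case=> j; rewrite !inE => h [-> ->].
rewrite big_distrr /= -!sum_nat_const -big_split /=; apply: leq_sum => x _.
rewrite -{1}(card_ord m) -(cardsC (D1 x :|: D2 x)) mulnDr addnC leq_add2l.
rewrite mul2n -addnn; apply: leq_trans (leq_add (D1n x) (D2n x)).
by rewrite -mulnDr leq_mul2l cardsU leq_subr orbT.
Qed.

(** Adds up the gains of [t] refinements, with [block_count T] as a common bound so that every round
    has the same error. *)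
Lemma iterated_refinement (n a T t : nat) :
  #|V| <= n -> #|W| <= n -> t <= T ->
  exists (I J : finType) (P : V -> I) (Q : W -> J),
    [/\ #|I| <= block_count t, #|J| <= block_count t &
     t * (#|A| * (a * m)) <=
       a ^ 3 * #|vacant P Q| + t * (#|A| * (2 * (n + a * block_count T)))].
Proof.
move=> Vn Wn; elim: t => [|t IH] tT.
  by exists unit, unit, (fun=> tt), (fun=> tt); rewrite card_unit.
have [I [J [P [Q [Ik Jk IHt]]]]] := IH (ltnW tT).
have [F [FH Fc]] := many_edges_in_holes a P Q Vn Wn Ik Jk.
have [I' [J' [P' [Q' [Ik' Jk' h]]]]] := refine_vacant Ik Jk FH.
exists I', J', P', Q'; split=> //.
have step : a ^ 3 * #|vacant P Q| + a * #|F| <= a ^ 3 * #|vacant P' Q'|.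
  rewrite !(expnS a 2) -(mulnA a (a ^ 2)) -(mulnA a (a ^ 2)) -mulnDr.
  by rewrite leq_mul2l h orbT.
have mono : #|A| * (2 * (n + a * block_count t)) <=
            #|A| * (2 * (n + a * block_count T)).
  by rewrite !leq_mul ?leq_add ?leq_mul ?block_count_homo // ltnW.
rewrite !mulSn; lia.
Qed.

(* If this failed, each of the a ^ 3 refinements, with a = 4 h, would make more
   than n ^ 2 / a ^ 3 further vertex pairs vacant. *)
Lemma ordered_matchings_bound (n h : nat) :
  0 < n -> 0 < h -> #|A| <= n -> #|V| <= n -> #|W| <= n ->
  2 * (4 * h) * block_count ((4 * h) ^ 3) <= n ->
  #|A| * m * h <= n ^ 2.
Proof.
move=> n0 h0 An Vn Wn; set a := 4 * h; set T := a ^ 3 => nbig.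
have [I [J [P [Q [_ _ H]]]]] := iterated_refinement a Vn Wn (leqnn T).
rewrite leqNgt; apply/negP => big.
have vn : #|vacant P Q| <= n ^ 2.
  by apply: leq_trans (max_card _) _; rewrite card_prod expnS expn1 leq_mul.
have T0 : 0 < T by rewrite expn_gt0 muln_gt0 h0.
have : #|A| * (a * m) <= n ^ 2 + #|A| * (2 * (n + a * block_count T)).
  rewrite -(leq_pmul2l T0) mulnDr; apply: leq_trans H _.
  by rewrite leq_add2r leq_mul2l vn orbT.
(* The right-hand side above is at most [(1 + 2 + 1) * n ^ 2]; the factor 4 in [a] absorbs this. *)
have : #|A| * n <= n ^ 2 by rewrite expnS expn1 leq_mul2r An orbT.
have : #|A| * (2 * a * block_count T) <= n ^ 2 by rewrite expnS expn1 leq_mul.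
rewrite {2}/a; move: big; set N2 := n ^ 2; nia.
Qed.

End Vacancy.

Local Open Scope fset_scope.

(** * Product sets and the greedy choice of pairs *)

Section ProductSets.
Variable G : groupType.
Implicit Types S T U X : {fset G}.

Lemma setmulfP S T z :
  reflect (exists s t, [/\ s \in S, t \in T & z = (s * t)%g])
          (z \in setmulf S T).
Proof.
apply: (iffP idP) => [/imfset2P[s /= sS [t /= tT ->]]|[s [t [sS tT ->]]]].
  by exists s, t.
exact: in_imfset2.
Qed.

Lemma mem_setmulf S T s t : s \in S -> t \in T -> (s * t)%g \in setmulf S T.
Proof. by move=> sS tT; apply/setmulfP; exists s, t. Qed.

Lemma leq_card_setmulfl S T : T != fset0 -> #|` S| <= #|` setmulf S T|.
Proof.
case/fset0Pn => t tT.
have <- : #|` [fset (s * t)%g | s in S]| = #|` S|.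
  by rewrite card_imfset //=; apply: mulIg.
apply: fsubset_leq_card; apply/fsubsetP => _ /imfsetP[s sS ->].
exact: mem_setmulf.
Qed.

Lemma leq_card_setmulfr S T : S != fset0 -> #|` T| <= #|` setmulf S T|.
Proof.
case/fset0Pn => s sS.
have <- : #|` [fset (s * t)%g | t in T]| = #|` T|.
  by rewrite card_imfset //=; apply: mulgI.
apply: fsubset_leq_card; apply/fsubsetP => _ /imfsetP[t tT ->].
exact: mem_setmulf.
Qed.

Lemma setmulf_neq0 S T : S != fset0 -> T != fset0 -> setmulf S T != fset0.
Proof.
move=> /fset0Pn[s sS] /fset0Pn[t tT]; apply/fset0Pn.
by exists (s * t)%g; apply: mem_setmulf.
Qed.

(** Here [p] is chosen before [q]; the relation need not be symmetric. *)
Definition fresh_after S T (p q : G * G) : bool :=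
  ((q.1 * q.2)%g \notin setmulf [fset p.1] T) &&
  ((q.1 * q.2)%g \notin setmulf S [fset p.2]).

Lemma fresh_afterP S T (p q : G * G) : p.1 \in S -> p.2 \in T ->
  q.1 \in S -> q.2 \in T -> fresh_after S T p q ->
  [/\ q.1 <> p.1, q.2 <> p.2 & (q.1 * q.2)%g <> (p.1 * p.2)%g].
Proof.
move=> p1 p2 q1 q2 /andP[/negP h1 /negP h2]; split=> e.
- by apply: h1; rewrite e; apply: mem_setmulf; rewrite ?inE.
- by apply: h2; rewrite e; apply: mem_setmulf; rewrite ?inE.
- by apply: h1; rewrite e; apply: mem_setmulf; rewrite ?inE.
Qed.

Definition fresh_seq S T (L : seq (G * G)) : bool :=
  pairwise (fresh_after S T) L && all (fun p => (p.1 \in S) && (p.2 \in T)) L.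

(** The first coordinates are distinct; this makes the greedy choice stop. *)
Lemma size_fresh_seq S T L : fresh_seq S T L -> size L <= #|` S|.
Proof.
case/andP => pwL memL; rewrite -(size_map (fun p : G * G => p.1)).
apply: uniq_leq_size; last first.
  by move=> _ /mapP[p /(allP memL) /andP[p1 _] ->].
rewrite uniq_pairwise pairwise_map.
apply: (sub_in_pairwise _ memL pwL) => p q /andP[p1 p2] /andP[q1 q2] /= pq.
by have [/eqP h _ _] := fresh_afterP p1 p2 q1 q2 pq; rewrite eq_sym.
Qed.

Lemma exists_covering_fresh_seq S T : exists2 L, fresh_seq S T L &
  setmulf S T = setmulf [fset p.1 | p in L] T `|` setmulf S [fset p.2 | p in L].
Proof.
pose covered (L : seq (G * G)) :=
   setmulf [fset p.1 | p in L] T `|` setmulf S [fset p.2 | p in L].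
suff [L LF sub] : exists2 L, fresh_seq S T L & setmulf S T `<=` covered L.
  exists L => //; apply/eqP; rewrite eqEfsubset sub /=.
  have /andP[_ /allP memL] := LF.
  rewrite fsubUset; apply/andP; split;
    apply/fsubsetP => z /setmulfP[s [t [sS tT ->]]]; apply: mem_setmulf => //.
  - by move: sS => /imfsetP[p /= /memL /andP[h _] ->].
  - by move: tT => /imfsetP[p /= /memL /andP[_ h] ->].
(* Induction on the room left in [S], which shrinks with each appended pair. *)
suff H n L : fresh_seq S T L -> #|` S| - size L < n ->
    exists2 L, fresh_seq S T L & setmulf S T `<=` covered L.
  exact: (H _ [::] isT (ltnSn _)).
elim: n L => // n IH L LF nL.
have [sub|] := boolP (setmulf S T `<=` covered L); first by exists L.
case/fsubsetPn => z /setmulfP[s [t [sS tT ->]]].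
rewrite inE negb_or => /andP[/negP n1 /negP n2].
have LF' : fresh_seq S T (rcons L (s, t)).
  have /andP[pwL memL] := LF.
  rewrite /fresh_seq pairwise_rcons pwL all_rcons memL /= sS tT !andbT.
  apply/allP => p pL; apply/andP; split; apply/negP => /=.
    case/setmulfP => s' [t' [/fset1P -> t'T e]]; apply: n1; rewrite e.
    by apply: mem_setmulf => //; apply/imfsetP; exists p.
  case/setmulfP => s' [t' [s'S /fset1P -> e]]; apply: n2; rewrite e.
  by apply: mem_setmulf => //; apply/imfsetP; exists p.
by apply: (IH _ LF'); have := size_fresh_seq LF'; rewrite size_rcons; lia.
Qed.

End ProductSets.

(** * The bipartite graph between XS and XST *)

Section Application.
Variables (G : groupType) (S T X : {fset G}) (L : seq (G * G)).
Hypotheses (T0 : T != fset0) (S0 : S != fset0) (X0 : X != fset0).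
Hypothesis LF : fresh_seq S T L.

Lemma fresh_seq_bound (h : nat) : 0 < h ->
  2 * (4 * h) * block_count ((4 * h) ^ 3) <= #|` setmulf (setmulf X S) T| ->
  #|` X| * size L * h <= #|` setmulf (setmulf X S) T| ^ 2.
Proof.
move=> h0 Zbig; have /andP[pwL /allP memL] := LF.
pose p (i : 'I_(size L)) := nth (1%g, 1%g) L i.
have pS i : (p i).1 \in S by have /andP[] := memL _ (mem_nth (1%g, 1%g) (ltn_ord i)).
have pT i : (p i).2 \in T by have /andP[] := memL _ (mem_nth (1%g, 1%g) (ltn_ord i)).
have pF (i k : 'I_(size L)) : i < k -> fresh_after S T (p i) (p k).
  by move=> ik; apply: (pairwiseP (1%g, 1%g) pwL); rewrite ?inE.
have pN (i k : 'I_(size L)) : i <> k ->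
    [/\ (p i).1 <> (p k).1, (p i).2 <> (p k).2 &
        ((p i).1 * (p i).2)%g <> ((p k).1 * (p k).2)%g].
  move=> /eqP; rewrite neq_ltn => /orP[] /pF F.
    by have [h1 h2 h3] := fresh_afterP (pS i) (pT i) (pS k) (pT k) F; split=> /esym.
  exact: (fresh_afterP (pS k) (pT k) (pS i) (pT i) F).
have bmem (x : X) i : (val x * (p i).1)%g \in setmulf X S.
  by apply: mem_setmulf; [apply: valP | apply: pS].
have cmem (x : X) i : (val x * (p i).1 * (p i).2)%g \in setmulf (setmulf X S) T.
  by apply: mem_setmulf.
have XS0 := setmulf_neq0 X0 S0; have Z0 := setmulf_neq0 XS0 T0.
have leXS := leq_card_setmulfl X S0; have leZ := leq_card_setmulfl (setmulf X S) T0.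
rewrite [#|` X|]cardfE.
apply: (@ordered_matchings_bound (setmulf X S) (setmulf (setmulf X S) T)
  (fun v w => ((val v)^-1 * val w)%g \in T) X (size L)
  (fun x i => [` bmem x i]) (fun x i => [` cmem x i])); rewrite -?cardfE //.
- move=> x i k /(congr1 val) /= /mulgI e.
  by have [//|/eqP/pN[]] := eqVneq i k.
- move=> x i k /(congr1 val) /=; rewrite -!mulgA => /mulgI e.
  by have [//|/eqP/pN[]] := eqVneq i k.
(* An edge (v, w) determines t_i = v^-1 w, hence [i], and then x by cancelling s_i. *)
- move=> [x i] [y k] [] /= e1; rewrite e1 => /mulgI e2.
  have [ik|/eqP/pN[]//] := eqVneq i k.
  by move: e1; rewrite ik => /mulIg /val_inj ->.
- by move=> x i; rewrite /= mulKg.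
(* An edge from x s_i to x z_k would put z_k into s_i T. *)
- move=> x i k /pF/andP[/negP F _]; apply/negP => /= H; apply: F.
  rewrite (_ : (_ * _)%g = ((p i).1 * ((val x * (p i).1)^-1 * (val x * (p k).1 * (p k).2)))%g).
    by apply: mem_setmulf; rewrite ?inE.
  by rewrite invgM -!mulgA mulKg mulVKg.
- by rewrite cardfs_gt0.
- exact: leq_trans leZ.
Qed.

End Application.

(** * From the finite bound to the rate [f] *)

Lemma leq_card_fset_of_seq (K K' : choiceType) (f : K -> K') (s : seq K) :
  #|` [fset f x | x in s]| <= size s.
Proof.
rewrite -(size_map f); apply: uniq_leq_size => [|_ /imfsetP[x /= xs ->]].
  exact: fset_uniq.
exact: map_f.
Qed.

(** The size that [fresh_seq_bound] asks for with [h = 2 * k.+1]; the 2 pays for [S'] and [T']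
    having up to [size L] elements each. *)
Definition size_threshold (k : nat) : nat :=
  2 * (4 * (2 * k.+1)) * block_count ((4 * (2 * k.+1)) ^ 3).

Lemma small_cover (G : groupType) (S T X : {fset G}) (k : nat) :
  S != fset0 -> T != fset0 -> X != fset0 ->
  let Z := setmulf (setmulf X S) T in
  (k == 0) || (size_threshold k <= #|` Z|) ->
  exists S' T' : {fset G},
    [/\ S' `<=` S, T' `<=` T, setmulf S T = setmulf S' T `|` setmulf S T' &
        #|` X| * (#|` S'| + #|` T'|) * k.+1 <= #|` Z| ^ 2].
Proof.
move=> S0 T0 X0 Z /orP[/eqP->|kZ].
  (* For [k = 0] the trivial cover suffices, since X and S each have at most |Z| elements. *)
  exists S, fset0; split; rewrite ?fsub0set //.
    apply/eqP; rewrite eqEfsubset fsubsetUl fsubUset fsubset_refl /=.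
    by apply/fsubsetP => z /setmulfP[s [t []]]; rewrite in_fset0.
  rewrite cardfs0 addn0 muln1 expnS expn1.
  have XS0 := leq_card_setmulfl (setmulf X S) T0.
  apply: leq_mul; first exact: leq_trans (leq_card_setmulfl X S0) XS0.
  exact: leq_trans (leq_card_setmulfr S X0) XS0.
have [L LF cov] := exists_covering_fresh_seq S T.
have /andP[_ /allP memL] := LF.
exists [fset p.1 | p in L], [fset p.2 | p in L]; split=> //.
- by apply/fsubsetP => _ /imfsetP[p /memL /andP[h _] ->].
- by apply/fsubsetP => _ /imfsetP[p /memL /andP[_ h] ->].
apply: leq_trans (fresh_seq_bound T0 S0 X0 LF (_ : 0 < 2 * k.+1) kZ) => //.
rewrite mulnA leq_mul2r; apply/orP; right.
rewrite -mulnA leq_mul2l; apply/orP; right; rewrite muln2 -addnn.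
by apply: leq_add; apply: leq_card_fset_of_seq.
Qed.

(** A rough inverse of [size_threshold]; it is 0 when no [k] qualifies, a value that [small_cover]
    accepts for every Z. *)
Definition accuracy (N : nat) : nat :=
  \max_(k < N.+1 | size_threshold k <= N) k.

Lemma accuracy_ok N : (accuracy N == 0) || (size_threshold (accuracy N) <= N).
Proof.
rewrite /accuracy; apply: (big_ind (fun k => (k == 0) || (size_threshold k <= N))) => //.
  by move=> x y hx hy; rewrite /maxn; case: ifP.
by move=> k ->; rewrite orbT.
Qed.

Lemma accuracy_unbounded k N : k <= N -> size_threshold k <= N -> k <= accuracy N.
Proof.
move=> kN h; have kN' : k < N.+1 by [].
exact: (@leq_bigmax_cond _ (fun k : 'I_N.+1 => size_threshold k <= N) val (Ordinal kN')).
Qed.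

Theorem theorem5p1 :
  exists f : nat -> R,
    (forall N : nat, (0 < f N)%R) /\ Un_cv f 0%R /\
    forall (G : groupType) (S T X : {fset G}),
      S != fset0 -> T != fset0 -> X != fset0 ->
      let Z := setmulf (setmulf X S) T in
      exists (S' T' : {fset G}),
        S' `<=` S /\ T' `<=` T /\
        setmulf S T = setmulf S' T `|` setmulf S T' /\
        (INR (#|` S'| + #|` T'|)%nat <= f #|` Z| * (INR #|` Z|)^2 / INR #|` X|)%R.
Proof.
have INR_pos n : (0 < INR n.+1)%R by apply: lt_0_INR; lia.
(* The successor keeps the denominator positive where [accuracy N] is 0. *)
exists (fun N => (/ INR (accuracy N).+1)%R); split.
  by move=> N; apply: Rinv_0_lt_compat.
split.
  move=> eps eps0.
  have [k [keps k0]] := archimed_cor1 eps eps0.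
  (* [N] must also reach [k], as [accuracy N] is a maximum over values up to [N]. *)
  exists (maxn k (size_threshold k)) => N Nk.
  have kN : k <= accuracy N by apply: accuracy_unbounded; lia.
  rewrite /Rdist Rminus_0_r Rabs_pos_eq; last exact/Rlt_le/Rinv_0_lt_compat.
  apply: Rle_lt_trans keps; apply: Rinv_le_contravar.
    by apply: lt_0_INR; lia.
  by apply: le_INR; lia.
move=> G S T X S0 T0 X0 Z.
have [S' [T' [sS sT cov bound]]] := small_cover S0 T0 X0 (accuracy_ok #|` Z|).
exists S', T'; split=> //; split=> //; split=> //.
have X0' : (0 < INR #|` X|)%R.
  by apply: lt_0_INR; apply/ltP; rewrite cardfs_gt0.
have := le_INR _ _ (elimT leP bound).
rewrite expnS expn1 !mult_INR => {}bound.
set a := INR (accuracy _).+1 in bound *.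
have a0 : (0 < a)%R by apply: INR_pos.
apply: (Rmult_le_reg_r (INR #|` X| * a)); first exact: Rmult_lt_0_compat.
rewrite -/Z in bound; field_simplify; first lra.
by split; apply: Rgt_not_eq.
Qed.
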